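(* Let $n\geq 5$ be an integer. For any edge $e$ of the prime difference graph $G_n$, there exists a Hamilton cycle of $G_n$ containing $e$.
   Context: For a positive integer $n$, the prime difference graph $G_n$ of order $n$ is the graph with vertex set $\{1,2,\dots,n\}$ in which two vertices $u,v$ are adjacent if and only if $|u-v|$ is a prime number. A Hamilton cycle is a cycle visiting each vertex of the graph exactly once. *)

(* Defs.v *)
From mathcomp Require Import all_boot all_order all_algebra.

Set Implicit Arguments.
Unset Strict Implicit.
Unset Printing Implicit Defensive.

Section SimpleGraph.

(* A simple graph on T is a symmetric irreflexive relation; an edge is the
   unordered pair of its ends. *)
Variables (T : finType) (adj : rel T).

Definition edge_set : {set {set T}} :=
  [set [set uv.1; uv.2] | uv : T * T & adj uv.1 uv.2].

(* The cyclic sequence c is closed up by the step from its last to its first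
   vertex; size at least 3 excludes c = [:: u; v], which would traverse the
   single edge uv twice. *)
Definition hamilton_cycle (c : seq T) : Prop :=
  [/\ 3 <= size c, cycle adj c, uniq c & forall x, x \in c].

Definition cycle_edges (c : seq T) : {set {set T}} :=
  [set [set x; next c x] | x in c].

End SimpleGraph.

(* The vertices 1, ..., n are encoded by the ordinals 0, ..., n - 1. *)
Definition vlabel (n : nat) (i : 'I_n) : nat := i.+1.

Definition prime_diff_graph (n : nat) : rel 'I_n :=
  fun u v => prime `|vlabel u - vlabel v|%N.

Lemma prime_diff_graph_sym (n : nat) : symmetric (@prime_diff_graph n).
Proof. by move=> u v; rewrite /prime_diff_graph IntDist.distnC. Qed.

Lemma prime_diff_graph_irrefl (n : nat) : irreflexive (@prime_diff_graph n).
Proof. by move=> u; rewrite /prime_diff_graph IntDist.distnn. Qed.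

(* Main.v *)
Require Import Defs.
From mathcomp Require Import all_boot all_order all_algebra.
From mathcomp Require Import zify.

(** Number the vertices 0, ..., n - 1, let the chosen edge join a and a + d, with d
prime, and write n = a + d + b + 1.  A Hamilton cycle through that edge is the
edge together with a Hamilton path from a to a + d.  Steps of length 2, 3, 5
and 7 suffice for such a path, and d enters only through the position of its
ends ([spans_small], [spans_large]).

The period 5 comes from the fact that five consecutive vertices induce the
5-cycle 0 3 1 4 2.  If a path uses the step between 1 and 4, five new vertices
can be put below vertex 0: renumber the old vertices by adding 5, and replace
the step between 6 and 9 by the detour 6 4 1 3 0 2 9.  The detour again steps
between 1 and 4, so the operation can be repeated and a grows by any multiple
of 5 ([spans_extend]).  Reflecting the path ([spans_mirror]) gives the same for
b.  Finally, paths on two adjacent intervals can be concatenated when the last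
vertex of the first and the first vertex of the second are at distance 2, 3, 5
or 7 ([spans_cat]); the end vertices of the joint path can then be arbitrarily
far apart.

When d >= 11, the path is a concatenation of a left part, which takes care of a,
and the reflection of a left part, which takes care of b.  A left part runs from
a to the third vertex from the top of its interval, so that the two parts are
joined by a step of length 5; appending copies of the path 0 3 1 4 2 makes it
longer by multiples of 5 ([spans_left_part]).  Hence only finitely many left
parts have to be found.  When d is 2, 3, 5 or 7, the whole path is obtained by
extending one of finitely many paths at the ends.  A verified depth first search
finds all the paths needed as a start. *)

Set Implicit Arguments.
Unset Strict Implicit.
Unset Printing Implicit Defensive.

(** * Steps of a path *)

Definition gap (u v : nat) : nat := (u - v) + (v - u).

Definition step : rel nat := fun u v => gap u v \in [:: 2; 3; 5; 7].

Fixpoint linked (u v : nat) (s : seq nat) : bool :=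
  if s is x :: s' then
    (if s' is y :: _ then ((x, y) == (u, v)) || ((x, y) == (v, u)) else false)
      || linked u v s'
  else false.

Lemma stepC u v : step u v = step v u.
Proof. by rewrite /step /gap addnC. Qed.

(** A step of a concatenation lies on one side of any cut; the cut vertex is
kept on both sides so that no step is lost. *)
Lemma linked_cat u v s1 x s2 :
  linked u v (s1 ++ x :: s2) = linked u v (rcons s1 x) || linked u v (x :: s2).
Proof.
elim: s1 => [|y [|z s1] IH] //; first by rewrite /= !orbF.
by move: IH; rewrite /= => ->; rewrite !orbA.
Qed.

Lemma linked_split u v s : linked u v s ->
  exists s1 s2, s = s1 ++ u :: v :: s2 \/ s = s1 ++ v :: u :: s2.
Proof.
elim: s => [//|x [//|y s] IH]; rewrite [linked _ _ _]/= -/(linked u v (y :: s)).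
case/orP => [/orP[]/eqP[-> ->]|/IH[s1 [s2 H]]].
- by exists [::], s; left.
- by exists [::], s; right.
by exists (x :: s1), s2; case: H => ->; [left|right].
Qed.

Lemma linked_in u v s1 s2 : linked u v (s1 ++ u :: v :: s2).
Proof. by rewrite linked_cat /= eqxx orbT. Qed.

Lemma linkedC u v s : linked u v s = linked v u s.
Proof.
elim: s => [//|x [|y s] IH] //=.
by rewrite [_ || (_ == (v, u))]orbC; congr (_ || _).
Qed.

Lemma linked_infix u v t1 s t2 : linked u v s -> linked u v (t1 ++ s ++ t2).
Proof.
by case/linked_split => s1 [s2 [] ->];
  rewrite -catA /= catA; [|rewrite linkedC]; apply: linked_in.
Qed.

Lemma linked_rev u v s : linked u v s -> linked u v (rev s).
Proof.
case/linked_split => s1 [s2 [] ->]; rewrite rev_cat !rev_cons -!cats1 -!catA /=.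
  by rewrite linkedC linked_in.
exact: linked_in.
Qed.

Lemma linked_map f u v s : linked u v s -> linked (f u) (f v) (map f s).
Proof.
case/linked_split => s1 [s2 [] ->]; rewrite map_cat /= ?linked_in //.
by rewrite linkedC linked_in.
Qed.

Lemma linked_mem u v s : linked u v s -> (u \in s) && (v \in s).
Proof.
by case/linked_split => s1 [s2 [] ->]; rewrite !mem_cat !inE !eqxx !orbT.
Qed.

Lemma step_gap u v u' v' : gap u v = gap u' v' -> step u v = step u' v'.
Proof. by rewrite /step => ->. Qed.

Lemma step_addl m : {mono addn m : u v / step u v}.
Proof. by move=> u v; apply: step_gap; rewrite /gap; lia. Qed.

(** * Hamilton paths with prescribed ends *)

Definition traverses (a d b : nat) (s : seq nat) : bool :=
  let n := (a + d + b).+1 in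
  [&& sorted step s, uniq s, size s == n, all (gtn n) s,
      head 0 s == a & last 0 s == a + d].

(** The flags L and R ask for the step at which new vertices can be inserted
below 0, respectively (by reflection) above n - 1.  The bound 4 < n keeps the
subtractions from being truncated.  For n = 6 the two steps coincide, and an
insertion at one end would destroy the step needed at the other. *)
Definition extendable (L R : bool) (n : nat) (s : seq nat) : bool :=
  [&& L ==> linked 1 4 s, R ==> (4 < n) && linked (n - 5) (n - 2) s
    & L && R ==> (n != 6)].

(** Placing the two ends by the three lengths a, d and b makes an insertion change
a single length, and a reflection exchange a and b. *)
Definition spans (L R : bool) (a d b : nat) : Prop :=
  exists2 s, traverses a d b s & extendable L R (a + d + b).+1 s.

Lemma spans_plain L R a d b : spans L R a d b -> spans false false a d b.
Proof. by case=> s ts _; exists s. Qed.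

(** Reversing a path and reflecting its interval exchanges its ends twice, so that
the new path again runs upwards, while the steps to be extended trade places. *)
Lemma spans_mirror L R a d b : spans L R a d b -> spans R L b d a.
Proof.
case=> s /and5P[ss us /eqP sz al /andP[/eqP h /eqP l]] /and3P[HL HR H6].
rewrite /spans.
have -> : b + d + a = a + d + b by lia.
set N := a + d + b in sz al HR H6 *.
have lt x : x \in s -> x <= N by move/(allP al).
pose f x := N - x; exists (rev (map f s)).
  have NE : b + d + a = N by rewrite /N; lia.
  rewrite /traverses NE; apply/and5P; split.
  - rewrite rev_sorted sorted_map -(@eq_in_sorted _ (gtn N.+1) step) //.
    move=> x y; rewrite !inE /= stepC => Hx Hy.
    by apply: step_gap; rewrite /f /gap; lia.
  - rewrite rev_uniq map_inj_in_uniq // => x y /lt + /lt; rewrite /f; lia.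
  - by rewrite size_rev size_map sz.
  - by rewrite all_rev; apply/allP => _ /mapP[x _ ->]; rewrite /= /f; lia.
  case: (lastP s) sz h l => [//|p z] _ h l.
  have : head 0 (rcons p z) = a by [].
  move: l; rewrite last_rcons map_rcons rev_rcons /= -map_rev => -> h1.
  rewrite {1}/f; apply/andP; split; first by apply/eqP; rewrite /N; lia.
  apply/eqP; case: p h1 {h} => [/= za|y p /= ->]; first by rewrite /f /N; lia.
  by rewrite rev_cons map_rcons last_rcons /f /N; lia.
apply/and3P; split.
- apply/implyP => RT; move: HR; rewrite RT.
  move=> /andP[n4 /(linked_map f)/linked_rev].
  have -> : f (N.+1 - 5) = 4 by rewrite /f; lia.
  have -> : f (N.+1 - 2) = 1 by rewrite /f; lia.
  by rewrite linkedC.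
- apply/implyP => LT; move: HL; rewrite LT => lk.
  have /andP[_ /lt n4] := linked_mem lk; apply/andP; split=> //.
  move: (linked_rev (linked_map f lk)).
  have -> : f 1 = N.+1 - 2 by rewrite /f; lia.
  have -> : f 4 = N.+1 - 5 by rewrite /f; lia.
  by rewrite linkedC.
by rewrite andbC.
Qed.

(** * Five more vertices at one end *)

Definition insert_low (blk s1 : seq nat) (x y : nat) (s2 : seq nat) : seq nat :=
  map (addn 5) (rcons s1 x) ++ blk ++ map (addn 5) (y :: s2).

Lemma traverses_insert_low a d b blk s1 x y s2 :
    perm_eq blk (iota 0 5) -> path step (5 + x) (rcons blk (5 + y)) ->
  traverses a d b (s1 ++ x :: y :: s2) ->
  traverses (5 + a) d b (insert_low blk s1 x y s2).
Proof.
move=> pblk pth; set s := s1 ++ _; set s' := insert_low _ _ _ _ _.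
move=> /and5P[ss us /eqP sz al /andP[/eqP h /eqP l]].
have ps' : perm_eq s' (iota 0 5 ++ map (addn 5) s).
  rewrite /s' /insert_low /s -cat_rcons map_cat perm_sym perm_catCA.
  by rewrite perm_cat2l perm_cat2r perm_sym.
have NE : (5 + a + d + b).+1 = 5 + (a + d + b).+1 by rewrite !addSn.
rewrite /traverses NE; apply/and5P; split.
- move: ss; rewrite /s sorted_cat_cons /= => /and3P[ss1 _ ps2].
  move: pth; rewrite rcons_path => /andP[pblk1 pblk2].
  rewrite /s' /insert_low map_rcons cat_rcons sorted_cat_cons -map_rcons.
  rewrite (mono_sorted (step_addl 5)) ss1 cat_path pblk1 /= pblk2.
  by rewrite (mono_path (step_addl 5)).
- rewrite (perm_uniq ps') cat_uniq iota_uniq.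
  rewrite map_inj_uniq ?us ?andbT; last exact: addnI.
  by apply/hasPn => _ /mapP[z _ ->]; rewrite mem_iota -leqNgt leq_addr.
- by rewrite (perm_size ps') size_cat size_iota size_map sz.
- rewrite (perm_all _ ps') all_cat all_map; apply/andP; split.
    apply/allP => z; rewrite mem_iota /= => z5.
    exact: leq_trans z5 (leq_addr _ _).
  by apply: sub_all al => z /=; rewrite ltn_add2l.
rewrite /s' /insert_low map_rcons; move: h l.
rewrite /s !last_cat /= last_map => h ->.
by rewrite addnA eqxx andbT -h; case: (s1).
Qed.

(** Only the step between x and y is broken up by the insertion. *)
Lemma linked_insert_low u v blk s1 x y s2 : linked u v (s1 ++ x :: y :: s2) ->
  linked u v [:: x; y] || linked (5 + u) (5 + v) (insert_low blk s1 x y s2).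
Proof.
rewrite linked_cat -[x :: y :: s2]/([:: x] ++ y :: s2) linked_cat.
case/or3P => [lk|->//|lk]; apply/orP; right; rewrite /insert_low.
  exact: (@linked_infix _ _ [::] _ _ (linked_map (addn 5) lk)).
rewrite catA -[map _ (y :: s2)]cats0.
exact: linked_infix (linked_map (addn 5) lk).
Qed.

(** The blocks used are 4 1 3 0 2 and its reverse: each steps between 1 and 4, as
the next extension requires, and its ends 4 and 2 are at distances 2 and 7 from
6 and 9.  The step recorded at the top survives because, for n <> 6, it is a
different one. *)
Lemma spans_extend R a d b : spans true R a d b -> spans true R (5 + a) d b.
Proof.
case=> s ts /and3P[/= HL HR H6].
suff key x y blk s1 s2 : s = s1 ++ x :: y :: s2 ->
    (x, y) = (1, 4) \/ (x, y) = (4, 1) ->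
    perm_eq blk (iota 0 5) -> path step (5 + x) (rcons blk (5 + y)) ->
    linked 1 4 blk -> spans true R (5 + a) d b.
  have [s1 [s2 [E|E]]] := linked_split HL.
    by apply: (key 1 4 [:: 4; 1; 3; 0; 2] s1 s2) => //; left.
  by apply: (key 4 1 [:: 2; 0; 3; 1; 4] s1 s2) => //; right.
move=> E xy pblk pth lkb; rewrite E in ts HR.
exists (insert_low blk s1 x y s2); first exact: traverses_insert_low.
apply/and3P; split; rewrite /= ?[linked 1 4 _]linked_infix //;
  apply/implyP => RT; move: HR H6; rewrite RT /= => /andP[n5 lk] n6;
  rewrite -[(5 + a + d + b).+1]/(5 + (a + d + b).+1);
  move: (a + d + b).+1 n5 n6 lk => n n5 n6 lk;
  last by case: n n5 {n6 lk} => [|[]].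
rewrite -!addnBA //; last by apply: leq_trans n5.
have /orP[bad|//] := linked_insert_low blk lk.
move: bad n5 n6; rewrite /= !orbF !xpair_eqE.
by case: xy => -[-> ->]; clear; lia.
Qed.

(** * Concatenation *)

(** With the second path moved just above the first one, the b1 vertices above the
end of the first and the a2 vertices below the start of the second separate
these two ends, so the connecting step has length b1 + a2 + 1. *)
Lemma spans_cat L R a1 d1 b1 a2 d2 b2 : b1 + a2 + 1 \in [:: 2; 3; 5; 7] ->
  spans L false a1 d1 b1 -> spans false R a2 d2 b2 -> ~~ (L && R) ->
  spans L R a1 (d1 + (b1 + a2 + 1) + d2) b2.
Proof.
have NE : (a1 + (d1 + (b1 + a2 + 1) + d2) + b2).+1
          = (a1 + d1 + b1).+1 + (a2 + d2 + b2).+1 by lia.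
have jump : gap (a1 + d1) ((a1 + d1 + b1).+1 + a2) = b1 + a2 + 1.
  by rewrite /gap; lia.
rewrite -{1}jump -/(step _ _) => st {jump}.
case=> s1 /and5P[ss1 us1 /eqP sz1 al1 /andP[/eqP h1 /eqP l1]] /and3P[HL _ _].
case=> s2 /and5P[ss2 us2 /eqP sz2 al2 /andP[/eqP h2 /eqP l2]] /and3P[_ HR _].
move=> nLR.
set n1 := (a1 + d1 + b1).+1 in sz1 al1 st *.
set n2 := (a2 + d2 + b2).+1 in sz2 al2 HR *.
exists (s1 ++ map (addn n1) s2); rewrite /traverses /extendable NE -/n1 -/n2.
  apply/and5P; split.
  - case: s1 ss1 sz1 h1 l1 {us1 al1 HL} => [//|x p] /= px _ xa l1.
    rewrite cat_path px l1.
    case: s2 ss2 sz2 h2 l2 {us2 al2 HR} => [//|y q] /= + _ y2 l2.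
    rewrite {}y2 => py.
    by rewrite st /= (mono_path (step_addl n1)).
  - rewrite cat_uniq us1 map_inj_uniq ?us2 ?andbT; last exact: addnI.
    apply/hasPn => _ /mapP[z _ ->]; apply/negP => /(allP al1).
    by rewrite /= ltnNge leq_addr.
  - by rewrite size_cat size_map sz1 sz2.
  - rewrite all_cat all_map; apply/andP; split.
      by apply: sub_all al1 => z /=; apply: ltn_addr.
    by apply: sub_all al2 => z /=; rewrite ltn_add2l.
  case: s1 h1 sz1 {ss1 us1 al1 HL l1} => [//|x p] /= -> _; rewrite eqxx /=.
  case: s2 l2 sz2 {ss2 us2 al2 HR h2} => [//|y q] /= l2 _.
  by rewrite last_cat /= last_map l2 /n1; apply/eqP; lia.
apply/and3P; split.
- apply/implyP => LT; move: HL; rewrite LT /=.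
  exact: (@linked_infix _ _ [::]).
- apply/implyP => RT; move: HR; rewrite RT /= => /andP[n4 lk].
  apply/andP; split; first exact: ltn_addl.
  rewrite -!addnBA //; last by apply: leq_trans n4.
  rewrite -[map _ _]cats0; exact: linked_infix (linked_map (addn n1) lk).
by rewrite (negbTE nLR).
Qed.

(** * Search for the initial paths *)

(** Under call by value [has] would explore every branch of the search, because
both arguments of a disjunction are evaluated; a conditional stops at the first
success. *)
Fixpoint lazy_has (T : Type) (p : pred T) (s : seq T) : bool :=
  if s is x :: s' then (if p x then true else lazy_has p s') else false.

Lemma lazy_hasE (T : Type) (p : pred T) s : lazy_has p s = has p s.
Proof. by elim: s => //= x s ->. Qed.

(** Long steps downwards come first, so that the low vertices are used up early;
this order keeps the number of branches small.  A truncated difference can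
only propose vertex 0, and [step] filters it out unless it is a neighbour. *)
Definition moves (u : nat) (av : seq nat) : seq nat :=
  [seq v <- [:: u - 7; u - 5; u - 3; u - 2; u + 3; u + 2; u + 5; u + 7]
     | step u v & v \in av].

(** The path p is stored in reverse, av holds the vertices still to be placed and
k counts the placements to come.  The test at the leaves alone guarantees the
result. *)
Fixpoint dfs (k : nat) (goal : pred (seq nat)) (p av : seq nat) : bool :=
  if k is k'.+1 then
    lazy_has (fun v => dfs k' goal (v :: p) (rem v av)) (moves (head 0 p) av)
  else goal p.

Lemma dfs_sound k goal p av : dfs k goal p av -> exists q, goal q.
Proof.
elim: k p av => [|k IH] p av /=; first by exists p.
by rewrite lazy_hasE => /hasP[v _ /IH].
Qed.

(** The end vertex a + d is kept out of the search and appended to each candidate,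
so that no path reaches it too early. *)
Definition search (L R : bool) (a d b : nat) : bool :=
  let n := (a + d + b).+1 in
  dfs (n - 2)
    (fun p => let s := rev (a + d :: p) in
       traverses a d b s && extendable L R n s)
    [:: a] [seq v <- iota 0 n | (v != a) && (v != a + d)].

Lemma search_sound L R a d b : search L R a d b -> spans L R a d b.
Proof. by case/dfs_sound => p /andP[H1 H2]; exists (rev (a + d :: p)). Qed.

(** Passing to a + 5 or b + 5 is tried when the path for a and b itself does not
exist or cannot be extended; for d = 3 and a = 1 this happens because the ends
of the path are the vertices 1 and 4 themselves.  Varying a in the inner loop
is much faster when a <= b: for d = 3 and a = 1 the failing searches then
remain small. *)
Definition search_shifted (L R : bool) (a d b : nat) : bool :=
  lazy_has (fun j => lazy_has (fun i => search L R (5 * i + a) d (5 * j + b))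
                       (iota 0 L.+1)) (iota 0 R.+1).

(** For a = 1 and d = 3 the ends are the vertices 1 and 4, so the path cannot also
step between them; 8 represents the class of 3 modulo 5 instead. *)
Lemma left_part_searches :
  all (fun a => all (fun d => search true false a d 2) [:: 2; 4; 5; 6; 7; 8])
      (iota 0 5).
Proof. by vm_compute. Qed.

(** The flags L and R stand for the presence of further multiples of 5 below and
above.  By reflection a <= b suffices.  The condition 4 <= a + d + b, needed
when both flags are off, excludes the graphs on fewer than five vertices. *)
Lemma small_difference_searches :
  all (fun d => all (fun L => all (fun R => all (fun a => all (fun b =>
         [|| L, R | 4 <= a + d + b] ==> search_shifted L R a d b)
       (iota a (5 - a))) (iota 0 5)) [:: false; true]) [:: false; true])
      [:: 2; 3; 5; 7].
Proof. by vm_compute. Qed.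

(** * All the differences *)

Lemma spans_reach L R k l a d b : (~~ L -> k = 0) -> (~~ R -> l = 0) ->
  spans L R a d b -> spans L R (5 * k + a) d (5 * l + b).
Proof.
have iter R' m a' b' : spans true R' a' d b' -> spans true R' (5 * m + a') d b'.
  by elim: m => [//|m IH] /IH /spans_extend; rewrite mulnS addnA.
move=> k0 l0 sp.
have {k0}sp : spans L R (5 * k + a) d b.
  by case: L k0 sp => [_|-> //]; apply: iter.
case: R l0 sp => [_|-> //] /spans_mirror sp.
by apply: spans_mirror; apply: iter.
Qed.

(** With two vertices above its end, a path can be followed by a copy of 0 3 1 4 2
through a step of length 3, and the result again has two vertices above its
end.  Thus d matters modulo 5 only, like a. *)
Lemma spans_left_part a d : (d == 2) || (3 < d) -> spans true false a d 2.
Proof.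
elim/ltn_ind: d => d IH hd.
case: (ltnP 8 d) => d8.
  have -> : d = (d - 5) + (2 + 0 + 1) + 2 by lia.
  apply: spans_cat => //; first by apply: IH; lia.
  by exists [:: 0; 3; 1; 4; 2].
rewrite (divn_eq a 5) mulnC -[X in spans _ _ _ _ X]/(5 * 0 + 2).
apply: spans_reach => //; apply: search_sound.
move/allP: left_part_searches => /(_ (a %% 5)); rewrite mem_iota ltn_mod.
by move=> /(_ isT)/allP; apply; rewrite !inE; lia.
Qed.

(** A left part with d = 2 and a reflected left part for d - 7, which is at least
4, are joined by a step of length 2 + 2 + 1. *)
Lemma spans_large a d b : 10 < d -> spans false false a d b.
Proof.
move=> hd; have -> : d = 2 + (2 + 2 + 1) + (d - 7) by lia.
apply: spans_cat => //; first exact: (spans_plain (@spans_left_part a 2 isT)).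
apply: (@spans_plain false true); apply: spans_mirror.
by apply: spans_left_part; apply/orP; right; rewrite ltn_subRL.
Qed.

Lemma search_shifted_sound L R a d b : search_shifted L R a d b ->
  exists i j, [/\ i <= L, j <= R & spans L R (5 * i + a) d (5 * j + b)].
Proof.
rewrite /search_shifted lazy_hasE => /hasP[j]; rewrite mem_iota => jR.
rewrite lazy_hasE => /hasP[i]; rewrite mem_iota => iL /search_sound.
by exists i, j.
Qed.

Lemma spans_small a d b : d \in [:: 2; 3; 5; 7] -> 4 <= a + d + b ->
  spans false false a d b.
Proof.
wlog ab : a b / a %% 5 <= b %% 5 => [th hd n5|hd n5].
  case/orP: (leq_total (a %% 5) (b %% 5)) => ab; first exact: th.
  by apply/spans_mirror/th => //; move: n5; clear; lia.
pose L := 4 < a; pose R := 4 < b.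
have : search_shifted L R (a %% 5) d (b %% 5).
  have [a5 b5] : a %% 5 < 5 /\ b %% 5 < 5 by rewrite !ltn_mod.
  have ba : b %% 5 \in iota (a %% 5) (5 - a %% 5).
    by rewrite mem_iota subnKC ?ab ?b5 // ltnW.
  have aa : a %% 5 \in iota 0 5 by rewrite mem_iota a5.
  have bools c : c \in [:: false; true] by case: c.
  have /allP/(_ L (bools L)) := allP small_difference_searches d hd.
  move=> /allP/(_ R (bools R)) /allP/(_ _ aa) /allP/(_ _ ba) /implyP; apply.
  case: (ltnP 4 a) => [a4|a4]; first by rewrite /L a4.
  case: (ltnP 4 b) => [b4|b4]; first by rewrite /R b4 orbT.
  by rewrite !modn_small ?n5 ?orbT.
case/search_shifted_sound => i [j [iL jR sp]].
apply: (@spans_plain L R).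
have -> : a = 5 * (a %/ 5 - i) + (5 * i + a %% 5) by rewrite /L in iL; lia.
have -> : b = 5 * (b %/ 5 - j) + (5 * j + b %% 5) by rewrite /R in jR; lia.
apply: spans_reach; last by [].
  by rewrite /L; lia.
by rewrite /R; lia.
Qed.

(** * Hamilton cycles *)

Theorem theorem2p7 (n : nat) (hn : 5 <= n) (e : {set 'I_n})
    (he : e \in edge_set (@prime_diff_graph n)) :
  exists c : seq 'I_n,
    hamilton_cycle (@prime_diff_graph n) c /\ e \in cycle_edges c.
Proof.
have adjE (u v : 'I_n) : prime_diff_graph u v = prime (gap u v).
  rewrite /prime_diff_graph /vlabel /gap; congr (prime _); lia.
have step_prime u v : step u v -> prime (gap u v).
  by rewrite /step !inE => /or4P[] /eqP ->.
have [u [v [uv pr ->]]] : exists u v : 'I_n,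
    [/\ u < v, prime (v - u) & e = [set u; v]].
  case/imsetP: he => -[u v]; rewrite inE /= adjE => + ->.
  have gapE (i j : nat) : i < j -> gap i j = j - i by rewrite /gap; lia.
  case: (ltngtP u v) => [lt|lt|->] pr; last by rewrite /gap subnn in pr.
    by exists u, v; rewrite -(gapE _ _ lt).
  by exists v, u; rewrite setUC -(gapE _ _ lt) /gap addnC.
have [s] : spans false false u (v - u) (n.-1 - v).
  case: (ltnP 10 (v - u)) => hd; first exact: spans_large.
  apply: spans_small; last by have := ltn_ord v; lia.
  by move: (v - u) pr hd; do 11! case=> //.
case/and5P=> [ss us /eqP sz al /andP[/eqP h /eqP l]] _.
have NE : (u + (v - u) + (n.-1 - v)).+1 = n by have := ltn_ord v; lia.
rewrite NE in sz al; rewrite (subnKC (ltnW uv)) in l.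
(* The chosen edge closes the path: it joins the last vertex v to the head u. *)
case: n u v e hn he adjE uv pr sz al h l {NE} =>
  [|n] u v e hn he adjE uv pr sz al h l.
  by case: u {h uv l pr}.
case: s ss us sz al h l => [//|x p] px us sz al /= xu lv.
rewrite {x}xu in px us sz al lv; pose q : seq 'I_n.+1 := map inord p.
have qK : map val q = p.
  rewrite -map_comp map_id_in // => y yp; apply: inordK.
  by apply: (allP al); rewrite inE yp orbT.
have lq : last u q = v by apply: val_inj; rewrite -(last_map val) qK.
have uq : uniq (u :: q) by rewrite -(map_inj_uniq val_inj) /= qK.
have sq : size (u :: q) = n.+1 by move: sz; rewrite -{1}qK /= size_map.
exists (u :: q); split.
  split=> //; first by rewrite sq; apply: leq_trans hn.
  - rewrite /= rcons_path lq prime_diff_graph_sym adjE; apply/andP; split.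
      have : path (relpre val step) u q by rewrite -path_map qK.
      by apply: sub_path => y z /= /step_prime; rewrite adjE.
    by rewrite (_ : gap u v = v - u) // /gap; move: uv; clear; lia.
  - move=> y; have [|_ ->] := uniq_min_size uq (fun z _ => mem_enum 'I_n.+1 z).
      by rewrite size_enum_ord sq.
    by rewrite mem_enum.
have vq : v \in u :: q by rewrite -lq mem_last.
apply/imsetP; exists v => //; rewrite setUC; congr [set _; _].
by rewrite next_nth vq -lq index_last // nth_default.
Qed.
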